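(* Let $K,L\in\mathbb{R}^{l\times l}$ be constant skew-symmetric matrices, let $L_+\in\mathbb{R}^{l\times l}$ satisfy $L=L_+-L_+^T$, let $S:\mathbb{R}^l\to\mathbb{R}$ be a polynomial of degree at most three with polarised function $\bar S$, and let $D\in\mathbb{R}^{M\times M}$ be an antisymmetric matrix (a discretization of $\partial_x$). Assume periodic boundary conditions $z(x+P,t)=z(x,t)$ and put $\Delta x=P/M$. Let $z^n=(z_0^n,\ldots,z_{M-1}^n)$ with $z_j^n\in\mathbb{R}^l$ satisfy, for all $n\ge0$ and $j=0,\ldots,M-1$, the linearly implicit global energy-preserving (LIGEP) scheme $$K\delta_t z_j^n+L(D\mu_tz^{n})_j =3\,\partial_1\bar{S}(z_j^n,z_j^{n+1}).$$ Then for all $n\ge 0$ the scheme satisfies the discrete global energy conservation law $$\bar{\mathcal{E}}^{n+1}= \bar{\mathcal{E}}^{n}, \qquad \bar{\mathcal{E}}^{n}:=\Delta x\sum_{j=0}^{M-1} \bar{E}_{j}^n,$$ where $$\bar{E}_j^n = \bar{S}(z_j^n,z_j^{n},z_j^{n+1})+\tfrac{1}{3}(Dz^n)_j^TL_+ z_j^{n}+\tfrac{1}{3}(Dz^n)_j^TL_+ z_j^{n+1}+\tfrac{1}{3}(Dz^{n+1})_j^TL_+z_j^n.$$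
   Context: The scheme discretizes the multi-symplectic PDE $Kz_t+Lz_x=\nabla S(z)$, $z(x,t)\in\mathbb{R}^l$, on a uniform spatial grid of one period $P$ with $M$ points, with time step $\Delta t>0$; $z_j^n$ is the value at spatial index $j$ and time level $n$. Notation: $(Dz^n)_j=\sum_{k=0}^{M-1}D_{j,k}z_k^n\in\mathbb{R}^l$, and $$\delta_t v^n=\frac{v^{n+1}-v^n}{\Delta t},\qquad \mu_t v^n=\frac{v^{n+1}+v^n}{2}.$$ Polarisation: $S$ is written $S(y)=y^TQ(y)y+y^TBy+c^Ty+d$, where $Q(y)$ is the symmetric matrix, with entries homogeneous linear in $y$, equal to $\frac16$ times the homogeneous linear part of the Hessian $\nabla^2S(y)$, $B$ is the constant symmetric matrix equal to $\frac12$ times the constant part of $\nabla^2 S(y)$, $c\in\mathbb{R}^l$ and $d\in\mathbb{R}$. The polarised function $\bar S:\mathbb{R}^l\times\mathbb{R}^l\times\mathbb{R}^l\to\mathbb{R}$ is $$\bar S(\xi,y,w)=\xi^TQ(y)w+\tfrac13(\xi^TBy+y^TBw+w^TB\xi)+\tfrac13c^T(\xi+y+w)+d,$$ which is symmetric in its three arguments with $\bar S(y,y,y)=S(y)$. The notation $\partial_1\bar S(y,w)$ means the gradient of $\bar S$ with respect to its first argument (which does not depend on that argument), with second and third arguments $y,w$: $\partial_1\bar S(y,w)=Q(y)w+\tfrac13B(y+w)+\tfrac13c$. *)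

(* Defs.v *)
From mathcomp Require Import all_boot all_order all_algebra.
From mathcomp Require Import mpoly.
From mathcomp Require Import reals.

Set Implicit Arguments.
Unset Strict Implicit.
Unset Printing Implicit Defensive.

Import Order.TTheory GRing.Theory Num.Theory.
Local Open Scope ring_scope.

Section Polarisation.
Variables (R : realType) (l : nat).
Implicit Types (S : {mpoly R[l]}) (u v xi y w : 'cV[R]_l) (A : 'M[R]_l).

Definition bil u A v : R := (u^T *m A *m v) 0 0.

Definition dotv u v : R := (u^T *m v) 0 0.

(* A polynomial function R^l -> R is represented by its formal polynomial,
   which determines it and is determined by it since R is infinite. *)
Definition peval S y : R := S.@[fun i => y i 0].

Definition hessian S : 'M[{mpoly R[l]}]_l := \matrix_(i, j) S^`M(i)^`M(j).

(* S(y) = y^T Q(y) y + y^T B y + c^T y + d for S of degree at most 3. *)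
Definition polQ S y : 'M[R]_l :=
  6%:R^-1 *: map_mx (fun h => peval (pihomog mdeg 1 h) y) (hessian S).

Definition polB S : 'M[R]_l :=
  2%:R^-1 *: map_mx (fun h : {mpoly R[l]} => h@_0%MM) (hessian S).

Definition polc S : 'cV[R]_l := \col_i S@_(U_(i)%MM).

Definition pold S : R := S@_0%MM.

Definition Sbar S xi y w : R :=
  bil xi (polQ S y) w
  + 3%:R^-1 * (bil xi (polB S) y + bil y (polB S) w + bil w (polB S) xi)
  + 3%:R^-1 * dotv (polc S) (xi + y + w)
  + pold S.

(* The gradient of [xi |-> Sbar S xi y w], which is affine in [xi];
   polB S is symmetric. *)
Definition d1Sbar S y w : 'cV[R]_l :=
  polQ S y *m w + 3%:R^-1 *: (polB S *m (y + w)) + 3%:R^-1 *: polc S.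

End Polarisation.

Section TimeOperators.
Variables (R : realType) (V : lmodType R).
Implicit Types (v : nat -> V).

Definition delta_t (dt : R) v (n : nat) : V := dt^-1 *: (v n.+1 - v n).

Definition mu_t v (n : nat) : V := 2%:R^-1 *: (v n.+1 + v n).

End TimeOperators.

(* A grid function on one period: spatial indices are 0, ..., M - 1, and
   periodicity is accounted for by letting the full M x M matrix D act on
   these M values. *)
Notation grid R l M := {ffun 'I_M -> 'cV[R]_l}.

Section Scheme.
Variables (R : realType) (l M : nat).

Definition Dx (D : 'M[R]_M) (u : grid R l M) (j : 'I_M) : 'cV[R]_l :=
  \sum_(k < M) D j k *: u k.

Definition LIGEP (K L : 'M[R]_l) (S : {mpoly R[l]}) (D : 'M[R]_M) (dt : R)
    (z : nat -> grid R l M) : Prop :=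
  forall (n : nat) (j : 'I_M),
    K *m delta_t dt z n j + L *m Dx D (mu_t z n) j
    = 3%:R *: d1Sbar S (z n j) (z n.+1 j).

Definition Ebar (Lp : 'M[R]_l) (S : {mpoly R[l]}) (D : 'M[R]_M)
    (z : nat -> grid R l M) (n : nat) (j : 'I_M) : R :=
  Sbar S (z n j) (z n j) (z n.+1 j)
  + 3%:R^-1 * bil (Dx D (z n) j) Lp (z n j)
  + 3%:R^-1 * bil (Dx D (z n) j) Lp (z n.+1 j)
  + 3%:R^-1 * bil (Dx D (z n.+1) j) Lp (z n j).

Definition global_energy (dx : R) (Lp : 'M[R]_l) (S : {mpoly R[l]})
    (D : 'M[R]_M) (z : nat -> grid R l M) (n : nat) : R :=
  dx * \sum_(j < M) Ebar Lp S D z n j.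

End Scheme.

(* Main.v *)
Require Import Defs.
From mathcomp Require Import all_boot all_order all_algebra.
From mathcomp Require Import mpoly.
From mathcomp Require Import reals.
From mathcomp Require Import ring lra.

Set Implicit Arguments.
Unset Strict Implicit.
Unset Printing Implicit Defensive.

Import Order.TTheory GRing.Theory Num.Theory.
Local Open Scope ring_scope.

(** Write a, b, c for three consecutive levels z^n, z^(n+1), z^(n+2), at a
    grid point or on the whole grid.  Two ingredients make the energy of
    (b, c) equal to that of (a, b).

    The polarised function is affine in its first slot, with gradient
    [d1Sbar], and is invariant under cyclic shifts of its slots, because its
    cubic part is given by the third derivatives of S.  Going from (a, a, b)
    to (b, b, c) by replacing one argument at a time therefore gives
    [Sbar_increment]:
      Sbar(b,b,c) - Sbar(a,a,b) = (b - a).d1Sbar(b,c) + (c - a).d1Sbar(a,b),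
    and the two gradients are precisely the ones fixed by the scheme at the
    levels n + 1 and n.

    After substitution the K terms cancel at each grid point, by skewness
    of K and c - a = (c - b) + (b - a) ([skew_increment]).  For the L terms,
    let <u,v>_A be the sum over the grid of u_j . A (Dv)_j, called [gform].
    Since D is antisymmetric, <u,v>_A = - <v,u>_(A^T) ([gform_skew]).  Hence
    <u,v>_L = <u,v>_Lp + <v,u>_Lp is symmetric ([gform_split]), and the
    gradient part of the energy is the sum of the three forms
    - <u,v>_Lp / 3 over (u,v) = (a,a), (a,b), (b,a).  Conservation is then a
    linear identity between the values of < , >_Lp at pairs among a, b, c. *)

(** * Dot products *)

Section Dot.
Variables (R : realType) (l : nat).
Implicit Types (u v w : 'cV[R]_l) (A : 'M[R]_l) (k : R).

Lemma dotvC u v : dotv u v = dotv v u.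
Proof. by rewrite /dotv -[u^T *m v]trmxK trmx_mul trmxK mxE. Qed.

Lemma dotvDr u v w : dotv u (v + w) = dotv u v + dotv u w.
Proof. by rewrite /dotv mulmxDr mxE. Qed.

Lemma dotvZr k u v : dotv u (k *: v) = k * dotv u v.
Proof. by rewrite /dotv -scalemxAr mxE. Qed.

Lemma dotvNr u v : dotv u (- v) = - dotv u v.
Proof. by rewrite -scaleN1r dotvZr mulN1r. Qed.

Lemma dotvDl u v w : dotv (u + v) w = dotv u w + dotv v w.
Proof. by rewrite !(dotvC _ w) dotvDr. Qed.

Lemma dotvZl k u v : dotv (k *: u) v = k * dotv u v.
Proof. by rewrite !(dotvC _ v) dotvZr. Qed.

Lemma dotvBl u v w : dotv (u - v) w = dotv u w - dotv v w.
Proof. by rewrite !(dotvC _ w) dotvDr dotvNr. Qed.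

Lemma dotv_suml (I : finType) (F : I -> 'cV[R]_l) v :
  dotv (\sum_i F i) v = \sum_i dotv (F i) v.
Proof. by rewrite /dotv raddf_sum mulmx_suml summxE. Qed.

Lemma dotv_sumr (I : finType) (F : I -> 'cV[R]_l) v :
  dotv v (\sum_i F i) = \sum_i dotv v (F i).
Proof. by rewrite dotvC dotv_suml; apply: eq_bigr => i _; rewrite dotvC. Qed.

Lemma bilE u A v : bil u A v = dotv u (A *m v).
Proof. by rewrite /bil /dotv mulmxA. Qed.

Lemma dotv_mulmx_tr u A v : dotv u (A *m v) = dotv v (A^T *m u).
Proof. by rewrite [RHS]dotvC /dotv trmx_mul trmxK mulmxA. Qed.

Lemma skew_dotvC A u v :
  A^T = - A -> dotv u (A *m v) = - dotv v (A *m u).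
Proof. by move=> A_skew; rewrite dotv_mulmx_tr A_skew mulNmx dotvNr. Qed.

(** With v - u and w - u in the left slots, the two skew terms differ only
    by (v - u).A(v - u) = 0. *)
Lemma skew_increment A u v w : A^T = - A ->
  dotv (v - u) (A *m (w - v)) + dotv (w - u) (A *m (v - u)) = 0.
Proof.
move=> A_skew; have -> : w - u = (w - v) + (v - u) by rewrite addrA subrK.
rewrite (dotvDl (w - v)) (skew_dotvC (v - u) (w - v) A_skew).
have := skew_dotvC (v - u) (v - u) A_skew; lra.
Qed.

End Dot.

(** * The polarised function *)

Section Polarised.
Variables (R : realType) (l : nat) (S : {mpoly R[l]}).
Implicit Types (xi y w : 'cV[R]_l).

Lemma peval_pihomog1 (p : {mpoly R[l]}) y :
  peval (pihomog mdeg 1 p) y = \sum_k p@_(U_(k)%MM) * y k 0.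
Proof.
elim/mpolyind: p => [|c m p _ _ IHp].
  by rewrite pihomog0 /peval meval0 big1 // => k _; rewrite mcoeff0 mul0r.
rewrite /peval in IHp *; rewrite linearP /= mevalD mevalZ IHp.
under [RHS]eq_bigr => k _ do rewrite mcoeffD mcoeffZ mcoeffX mulrDl -mulrA.
rewrite big_split -mulr_sumr /=; congr (c * _ + _).
rewrite pihomogX; case: mdeg1P => [[i /eqP ->]|m_neq1].
  rewrite mevalXU (bigD1 i) //= eqxx mul1r big1 ?addr0 // => k k_neqi.
  by rewrite eq_mnm1 eq_sym (negbTE k_neqi) mul0r.
rewrite meval0 big1 // => k _; case: (boolP (m == _)) => [mE|_]; last by rewrite mul0r.
by case: m_neq1; exists k.
Qed.

(** Taking the coefficients of the linear part of the Hessian as third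
    derivatives at the origin makes every symmetry of the cubic part of
    [Sbar] an instance of [mderiv_comm]. *)
Lemma polQE y i j :
  polQ S y i j = 6%:R^-1 * \sum_k (S^`M(i)^`M(j)^`M(k))@_0%MM * y k 0.
Proof.
rewrite !mxE peval_pihomog1; congr (_ * _); apply: eq_bigr => k _.
by rewrite (mcoeff_deriv k 0%MM) mnm0E add0m.
Qed.

Lemma polQ_sym y : (polQ S y)^T = polQ S y.
Proof.
apply/matrixP => i j; rewrite mxE !polQE.
by under eq_bigr => k _ do rewrite (mderiv_comm j i).
Qed.

Lemma polQ_mulC y w : polQ S y *m w = polQ S w *m y.
Proof.
apply/matrixP => i j; rewrite (ord1 j) !mxE.
under eq_bigr => k _ do rewrite polQE -mulrA mulr_suml.
under [RHS]eq_bigr => k _ do rewrite polQE -mulrA mulr_suml.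
rewrite -!mulr_sumr exchange_big /=; congr (_ * _).
apply: eq_bigr => k _; apply: eq_bigr => m _.
by rewrite (mderiv_comm m k) mulrAC.
Qed.

Lemma Sbar_cyclic xi y w : Sbar S xi y w = Sbar S w xi y.
Proof.
rewrite /Sbar; congr (_ + _ + _ + _).
- by rewrite !bilE polQ_mulC dotv_mulmx_tr polQ_sym polQ_mulC
    dotv_mulmx_tr polQ_sym.
- by rewrite [bil xi _ _ + _ + _]addrC addrA.
- by rewrite [xi + y + w]addrC addrA.
Qed.

(** [d1Sbar] is the gradient in the first slot because B is symmetric. *)
Lemma Sbar_subl xi xi' y w :
  Sbar S xi y w - Sbar S xi' y w = dotv (xi - xi') (d1Sbar S y w).
Proof.
have B_sym : (polB S)^T = polB S.
  by apply/matrixP => i j; rewrite !mxE mderiv_comm.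
rewrite /Sbar /d1Sbar !bilE !(dotv_mulmx_tr w) !B_sym mulmxDr.
rewrite !(dotvBl, dotvDr, dotvZr) !(dotvC (polc S)).
ring.
Qed.

(** Path from (a, a, b) to (b, b, c): up to cyclic shifts, replace a by c
    next to (a, b), and then a by b next to (b, c). *)
Lemma Sbar_increment a b c :
  Sbar S b b c - Sbar S a a b
  = dotv (b - a) (d1Sbar S b c) + dotv (c - a) (d1Sbar S a b).
Proof. by rewrite -!Sbar_subl -(Sbar_cyclic a b c) addrA subrK. Qed.

End Polarised.

(** * Summation by parts on the grid *)

Section GridForm.
Variables (R : realType) (l M : nat) (D : 'M[R]_M).
Implicit Types (u v w : grid R l M) (A : 'M[R]_l).

Definition gform A u v : R := \sum_(j < M) dotv (u j) (A *m Dx D v j).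

Lemma DxD u v j : Dx D (u + v) j = Dx D u j + Dx D v j.
Proof.
by rewrite -big_split; apply: eq_bigr => k _; rewrite ffunE scalerDr.
Qed.

Lemma DxZ (k : R) u j : Dx D (k *: u) j = k *: Dx D u j.
Proof.
rewrite scaler_sumr; apply: eq_bigr => i _.
by rewrite ffunE !scalerA mulrC.
Qed.

Lemma gformBl A u v w : gform A (u - v) w = gform A u w - gform A v w.
Proof. by rewrite -sumrB; apply: eq_bigr => j _; rewrite !ffunE dotvBl. Qed.

Lemma gformDr A u v w : gform A u (v + w) = gform A u v + gform A u w.
Proof.
by rewrite -big_split; apply: eq_bigr => j _; rewrite DxD mulmxDr dotvDr.
Qed.

Lemma gformZr A (k : R) u v : gform A u (k *: v) = k * gform A u v.
Proof.
rewrite mulr_sumr; apply: eq_bigr => j _.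
by rewrite DxZ -scalemxAr dotvZr.
Qed.

Hypothesis D_skew : D^T = - D.

(** Antisymmetry of D is the discrete counterpart of integration by parts
    over one period. *)
Lemma gform_skew A u v : gform A u v = - gform A^T v u.
Proof.
have DE i j : D i j = - D j i by have /matrixP/(_ j i) := D_skew; rewrite !mxE.
rewrite /gform /Dx -sumrN.
under eq_bigr => j _ do rewrite mulmx_sumr dotv_sumr.
rewrite exchange_big; apply: eq_bigr => k _ /=.
rewrite mulmx_sumr dotv_sumr -sumrN; apply: eq_bigr => j _.
by rewrite DE -!scalemxAr !dotvZr mulNr dotv_mulmx_tr.
Qed.

Lemma gform_split A u v : gform (A - A^T) u v = gform A u v + gform A v u.
Proof.
rewrite [gform A v u]gform_skew -sumrB; apply: eq_bigr => j _.
by rewrite mulmxBl dotvDr dotvNr.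
Qed.

Lemma sum_bil_Dx A u v :
  \sum_(j < M) bil (Dx D u j) A (v j) = - gform A u v.
Proof.
rewrite gform_skew opprK; apply: eq_bigr => j _.
by rewrite bilE dotv_mulmx_tr.
Qed.

End GridForm.

(** * Energy conservation *)

Theorem theorem2 (R : realType) (l M : nat) (K L Lp : 'M[R]_l)
    (S : {mpoly R[l]}) (D : 'M[R]_M) (P dt : R) (z : nat -> grid R l M)
    (M_gt0 : (0 < M)%N) (P_gt0 : 0 < P) (dt_gt0 : 0 < dt)
    (K_skew : K^T = - K) (L_skew : L^T = - L) (L_split : L = Lp - Lp^T)
    (S_deg : (msize S <= 4)%N)
    (D_skew : D^T = - D)
    (scheme : LIGEP K L S D dt z) :
  forall n : nat,
    global_energy (P / M%:R) Lp S D z n.+1 = global_energy (P / M%:R) Lp S D z n.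
Proof.
move=> n; congr (_ * _).
have energyE m : \sum_(j < M) Ebar Lp S D z m j
    = \sum_(j < M) Sbar S (z m j) (z m j) (z m.+1 j)
      - 3%:R^-1 * (gform D Lp (z m) (z m) + gform D Lp (z m) (z m.+1)
                   + gform D Lp (z m.+1) (z m)).
  by rewrite !big_split -!mulr_sumr /= !sum_bil_Dx //; ring.
rewrite !energyE {energyE}.
set a := z n; set b := z n.+1; set c := z n.+2.
have potential : 3%:R * (\sum_(j < M) Sbar S (b j) (b j) (c j)
                         - \sum_(j < M) Sbar S (a j) (a j) (b j))
    = gform D L (b - a) (mu_t z n.+1) + gform D L (c - a) (mu_t z n).
  rewrite -sumrB mulr_sumr -big_split /=; apply: eq_bigr => j _.
  (* The factor 3 turns each gradient into a right-hand side of the scheme. *)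
  rewrite Sbar_increment mulrDr -!dotvZr -!scheme !dotvDr !ffunE.
  rewrite -!scalemxAr !dotvZr.
  have := skew_increment (a j) (b j) (c j) K_skew.
  move/(congr1 ( *%R dt^-1)); rewrite mulr0 mulrDr => Kterms.
  by rewrite addrACA Kterms add0r.
move: potential; rewrite /mu_t -/a -/b -/c.
rewrite !(gformBl, gformZr, gformDr) L_split !gform_split //.
lra.
Qed.
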